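(* Let $0<p<1$. The weaver's hem $W(p)$ and Mandelbrot's `binomial measure' with parameter $p$ (the limit of the $p$ model) are equivalent, i.e. they are the same probability distribution on $[0,1]$.
   Context: Weaver's distribution $W(n,p)$ ($n\ge 1$, $0<p<1$): the discrete distribution on the points $y_{k,n}=k/(2^n-1)$, $k=0,\ldots,2^n-1$, with probabilities $p_k=p^{\#1}(1-p)^{\#0}$, where $\#1$ and $\#0$ are the numbers of ones and zeros in the $n$-digit binary representation of $k$. The weaver's hem $W(p)$ is the distribution whose distribution function is $F=\lim_{n\to\infty}F_n$, where $F_n$ is the distribution function of $W(n,p)$. The $p$ model: start with the uniform distribution on $(0,1)$; at each step halve every interval, giving the proportion $1-p$ of its mass to the left half and the proportion $p$ to the right half, spread uniformly in each half. After $n$ steps this yields a probability distribution with a density that is constant on each interval $(k/2^n,(k+1)/2^n)$, $k=0,\ldots,2^n-1$. Mandelbrot's `binomial measure' is the limit distribution (in the sense of convergence of distribution functions) of the $p$ model as $n\to\infty$. *)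

(* Defs.v *)
From HB Require Import structures.
From mathcomp Require Import all_boot all_order all_algebra.
From mathcomp Require Import all_classical all_reals all_analysis.
Set Implicit Arguments.
Unset Strict Implicit.
Unset Printing Implicit Defensive.
Import Order.TTheory GRing.Theory Num.Theory.
Import numFieldNormedType.Exports.
Local Open Scope classical_set_scope.
Local Open Scope ring_scope.

(* [binary_digit k i] is the digit of weight [2 ^ i] of [k]; in the two counts
   below leading zeros are included, so that
   [num_ones n k + num_zeros n k = n]. *)
Definition binary_digit (k i : nat) : bool := odd (k %/ 2 ^ i).

Definition num_ones (n k : nat) : nat :=
  #|[pred i : 'I_n | binary_digit k i]|.

Definition num_zeros (n k : nat) : nat :=
  #|[pred i : 'I_n | ~~ binary_digit k i]|.

Section Distributions.
Context {R : realType}.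
Implicit Types (p x : R) (n k : nat) (m : set R -> \bar R).

Definition weaver_point n k : R := k%:R / (2 ^ n - 1)%N%:R.

Definition weaver_pmf p n k : R :=
  p ^+ num_ones n k * (1 - p) ^+ num_zeros n k.

(* [W(n, p)] is meant for [0 < n]: for [n = 0] the only point is [0 / 0 = 0]. *)
Definition weaver_dist p n : set R -> \bar R := fun A =>
  (\sum_(k < 2 ^ n) (weaver_pmf p n k)%:E * \d_(weaver_point n k) A)%E.

Lemma dyadic_lt n k : k%:R / 2 ^+ n < k.+1%:R / 2 ^+ n :> R.
Proof. by rewrite ltr_pM2r ?invr_gt0 ?exprn_gt0// ltr_nat. Qed.

Definition dyadic_interval n k : set R :=
  `]k%:R / 2 ^+ n, k.+1%:R / 2 ^+ n[%classic.

Definition dyadic_uniform n k : set R -> \bar R :=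
  uniform_prob (dyadic_lt n k).

(* The left and right halves of the [k]-th dyadic interval of order [n] are
   those of indices [2 * k] and [2 * k + 1] of order [n.+1]. *)
Fixpoint p_model p n : set R -> \bar R :=
  if n is n'.+1 then fun A =>
    (\sum_(k < 2 ^ n') p_model p n' (dyadic_interval n' k) *
       ((1 - p)%:E * dyadic_uniform n'.+1 (2 * k) A +
        p%:E * dyadic_uniform n'.+1 (2 * k).+1 A))%E
  else uniform_prob (@ltr01 R).

Definition distribution_function m : R -> \bar R := fun x => m `]-oo, x]%classic.

Definition limit_distribution (m_ : nat -> set R -> \bar R)
    (mu : probability R R) : Prop :=
  forall x, distribution_function (m_ n) x @[n --> \oo] -->
            distribution_function mu x.

Definition is_weavers_hem p (mu : probability R R) : Prop :=
  limit_distribution (weaver_dist p) mu.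

Definition is_binomial_measure p (mu : probability R R) : Prop :=
  limit_distribution (p_model p) mu.

End Distributions.

(* Main.v *)
From HB Require Import structures.
Require Import Defs.
From mathcomp Require Import all_boot all_order all_algebra.
From mathcomp Require Import all_classical all_reals all_analysis.
From mathcomp Require Import measurable_realfun lra ring.
Import Order.TTheory GRing.Theory Num.Theory.
Import numFieldNormedType.Exports.
Local Open Scope classical_set_scope.
Local Open Scope ring_scope.

(** Both sequences distribute the same masses, [weaver_pmf p n k], over the
    dyadic intervals of order [n].  Weaver's distribution puts the [k]-th mass
    at the point [k / (2 ^ n - 1)], which belongs to the closed interval
    [[k / 2 ^ n, (k + 1) / 2 ^ n]] ([weaver_point_bounds]); the p model spreads
    it uniformly over that interval ([p_modelE]), since appending the digit 0
    or 1 to the index of an interval selects its left or right half and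
    multiplies the mass by [1 - p] or [p].

    Hence both distribution functions at [x] lie between [lower_mass], the
    total mass of the intervals ending at or before [x], and [upper_mass], the
    total mass of those starting at or before [x]
    ([weaver_dist_squeeze], [p_model_squeeze]).  The two bounds differ by the
    mass of at most one interval, thus by at most [max(p, 1 - p) ^ n]
    ([upper_lower]).  Halving the intervals can only raise the lower bound and
    lower the upper one, so both bounds, and with them both distribution
    functions, tend to one function, [binomial_cdf].

    The geometric bound also makes [binomial_cdf] right-continuous
    ([binomial_cdf_right_continuous]); being nondecreasing, equal to 0 on the
    negative numbers and to 1 from 1 on, it is the distribution function of a
    Lebesgue-Stieltjes probability, whence the existence of both limits.  Any
    two probabilities with this distribution function agree on the rays
    [`]x, +oo[], a pi-system generating the Borel sets, hence everywhere
    ([probability_cdf_unique]).  Finally [binomial_cdf 0 = 0] and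
    [binomial_cdf 1 = 1] put all the mass in the unit interval. *)

(** * Binary digits *)

Lemma big_ord_double (T : Type) (idx : T) (op : Monoid.law idx) (m : nat)
    (F : nat -> T) :
  \big[op/idx]_(k < 2 * m) F k =
  \big[op/idx]_(k < m) op (F (2 * k)%N) (F (2 * k).+1).
Proof.
elim: m => [|m IHm]; first by rewrite muln0 !big_ord0.
by rewrite mulnS add2n !big_ord_recr /= IHm Monoid.mulmA.
Qed.

Section Digits.
Implicit Types n k : nat.

Lemma binary_digitS (b : bool) k i :
  binary_digit (b + 2 * k) i.+1 = binary_digit k i.
Proof.
rewrite /binary_digit expnS divnMA addnC mulnC divnMDl//.
by rewrite (_ : b %/ 2 = 0)%N ?addn0//; case: b.
Qed.

Lemma binary_digit0 (b : bool) k : binary_digit (b + 2 * k) 0 = b.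
Proof. by rewrite /binary_digit expn0 divn1 oddD mul2n odd_double addbF; case: b. Qed.

Lemma num_onesS (b : bool) n k :
  num_ones n.+1 (b + 2 * k) = (b + num_ones n k)%N.
Proof.
rewrite /num_ones -!sum1_card big_mkcond big_ord_recl /= inE binary_digit0.
rewrite [in RHS]big_mkcond; congr addn.
by apply: eq_bigr => i _; rewrite !inE lift0 binary_digitS.
Qed.

Lemma num_zerosS (b : bool) n k :
  num_zeros n.+1 (b + 2 * k) = (~~ b + num_zeros n k)%N.
Proof.
rewrite /num_zeros -!sum1_card big_mkcond big_ord_recl /= inE binary_digit0.
rewrite [in RHS]big_mkcond; congr addn.
by apply: eq_bigr => i _; rewrite !inE lift0 binary_digitS.
Qed.

Lemma num_onesDzeros n k : (num_ones n k + num_zeros n k)%N = n.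
Proof. by rewrite /num_ones /num_zeros cardC card_ord. Qed.

End Digits.

(** * Masses of the dyadic intervals *)

Section Mass.
Context {R : realType} (p : R).
Hypothesis p01 : 0 < p < 1.
Implicit Types (x y : R).

Let p_ge0 : 0 <= p. Proof. by case/andP: p01 => /ltW. Qed.
Let q_ge0 : 0 <= 1 - p. Proof. by rewrite subr_ge0; case/andP: p01 => _ /ltW. Qed.

(** The two halves of an interval share its mass in the proportions [1 - p] and
    [p]: this is where the digit count of Weaver's distribution meets the
    recursion of the p model. *)
Lemma weaver_pmf_left n k :
  weaver_pmf p n.+1 (2 * k) = (1 - p) * weaver_pmf p n k.
Proof.
by rewrite /weaver_pmf (num_onesS false) (num_zerosS false) /= exprS mulrCA.
Qed.

Lemma weaver_pmf_right n k :
  weaver_pmf p n.+1 (2 * k).+1 = p * weaver_pmf p n k.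
Proof.
by rewrite /weaver_pmf (num_onesS true) (num_zerosS true) /= exprS mulrA.
Qed.

Lemma weaver_pmf0 : weaver_pmf p 0 0 = 1.
Proof. by rewrite /weaver_pmf /num_ones /num_zeros !eq_card0 ?mulr1//; case. Qed.

Lemma weaver_pmf_ge0 n k : 0 <= weaver_pmf p n k.
Proof. by rewrite mulr_ge0 ?exprn_ge0. Qed.

Lemma weaver_pmf_sum1 n : \sum_(k < 2 ^ n) weaver_pmf p n k = 1.
Proof.
elim: n => [|n IHn]; first by rewrite big_ord1 weaver_pmf0.
rewrite expnS big_ord_double -[RHS]IHn; apply: eq_bigr => k _.
by rewrite weaver_pmf_left weaver_pmf_right /= -mulrDl subrK mul1r.
Qed.

(** Each of the [n] digits contributes a factor [p] or [1 - p]. *)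
Lemma weaver_pmf_le n k : weaver_pmf p n k <= Num.max p (1 - p) ^+ n.
Proof.
rewrite /weaver_pmf -[X in _ <= _ ^+ X](num_onesDzeros n k) exprD.
by rewrite ler_pM ?exprn_ge0// lerXn2r ?nnegrE// ?le_max ?p_ge0 ?q_ge0 ?lexx ?orbT.
Qed.

Lemma cvg_max_expr : Num.max p (1 - p) ^+ n @[n --> \oo] --> (0 : R).
Proof.
apply: cvg_expr; rewrite ger0_norm ?le_max ?p_ge0// gt_max.
by case/andP: p01 => p0 ->; rewrite ltrBlDr ltrDl.
Qed.

(** The mass of the intervals lying entirely at the left of [x]; in
    [upper_mass] below, an interval that contains [x] counts as well. *)
Definition lower_mass n (x : R) : R :=
  \sum_(k < 2 ^ n | k.+1%:R <= x * 2 ^+ n) weaver_pmf p n k.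

Definition upper_mass n (x : R) : R :=
  \sum_(k < 2 ^ n | k%:R <= x * 2 ^+ n) weaver_pmf p n k.

Let weighted_sum_mono n (P Q : pred 'I_(2 ^ n)) : (forall k, P k -> Q k) ->
  \sum_(k | P k) weaver_pmf p n k <= \sum_(k | Q k) weaver_pmf p n k.
Proof.
move=> PQ; rewrite [leLHS]big_mkcond [leRHS]big_mkcond; apply: ler_sum => k _.
by case: ifPn => [/PQ ->//|_]; case: ifP => // _; exact: weaver_pmf_ge0.
Qed.

(* The masses of order [n.+1] and those of order [n] are both written as sums
   over the intervals of order [n], one term for each half, so that refining
   the partition can be analysed half by half. *)
Let mass_split n (P : pred nat) :
  \sum_(k < 2 ^ n.+1 | P k) weaver_pmf p n.+1 k =
  \sum_(k < 2 ^ n) ((1 - p) * weaver_pmf p n k *+ P (2 * k)%N +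
                    p * weaver_pmf p n k *+ P (2 * k).+1).
Proof.
rewrite big_mkcond expnS (big_ord_double _ _ _ _ (fun k => if P k then weaver_pmf p n.+1 k else 0)).
by apply: eq_bigr => k _; rewrite weaver_pmf_left weaver_pmf_right /= !mulrb.
Qed.

Let mass_unsplit n (P : pred 'I_(2 ^ n)) :
  \sum_(k | P k) weaver_pmf p n k =
  \sum_(k < 2 ^ n) ((1 - p) * weaver_pmf p n k *+ P k +
                    p * weaver_pmf p n k *+ P k).
Proof.
rewrite big_mkcond; apply: eq_bigr => k _.
by case: (P k); rewrite ?mulr0n ?addr0 ?mulr1n//; ring.
Qed.

(** If an interval ends at or before [x], then so do its halves. *)
Lemma lower_massS n x : lower_mass n x <= lower_mass n.+1 x.
Proof.
rewrite /lower_mass (mass_split n (fun k => k.+1%:R <= x * 2 ^+ n.+1)) mass_unsplit.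
have := weaver_pmf_ge0 n; move: (weaver_pmf p n) => w w0.
apply: ler_sum => k _; rewrite !mulrb.
have [kx|kx] := boolP (_ <= x * 2 ^+ n); last first.
  by rewrite addr0; apply: addr_ge0; case: ifP => // _; rewrite mulr_ge0.
have kx2 : (2 * k).+2%:R <= x * 2 ^+ n.+1.
  have -> : (2 * k).+2 = (2 * k.+1)%N by rewrite mulnS.
  by rewrite natrM exprS; lra.
by rewrite kx2 (le_trans _ kx2)// ler_nat.
Qed.

(** If a half starts at or before [x], then so does the whole interval. *)
Lemma upper_massS n x : upper_mass n.+1 x <= upper_mass n x.
Proof.
rewrite /upper_mass (mass_split n (fun k => k%:R <= x * 2 ^+ n.+1)) mass_unsplit.
have := weaver_pmf_ge0 n; move: (weaver_pmf p n) => w w0.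
apply: ler_sum => k _; rewrite !mulrb.
have [kx|kx] := boolP (k%:R <= x * 2 ^+ n).
  by apply: lerD; case: ifP => // _; rewrite mulr_ge0.
have kx2 : ((2 * k)%:R <= x * 2 ^+ n.+1) = false.
  by rewrite natrM exprS; apply/negbTE; move: kx; rewrite -!ltNge; lra.
have kx3 : ((2 * k).+1%:R <= x * 2 ^+ n.+1) = false.
  by apply: contraFF kx2; apply: le_trans; rewrite ler_nat.
by rewrite kx2 kx3.
Qed.

Lemma lower_mass_nondecreasing x : nondecreasing_seq (lower_mass ^~ x).
Proof. by apply/nondecreasing_seqP => n; exact: lower_massS. Qed.

Lemma upper_mass_nonincreasing x : nonincreasing_seq (upper_mass ^~ x).
Proof. by apply/nonincreasing_seqP => n; exact: upper_massS. Qed.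

Lemma lower_mass_le n : {homo lower_mass n : x y / x <= y}.
Proof.
move=> x y xy; apply: weighted_sum_mono => k /le_trans; apply.
by rewrite ler_pM2r// exprn_gt0.
Qed.

Lemma lower_upper n x : lower_mass n x <= upper_mass n x.
Proof.
by apply: weighted_sum_mono => k; apply: le_trans; rewrite ler_nat.
Qed.

(** An interval counted in the upper mass but not in the lower one starts at or
    before [x] and ends after it; half-open intervals being disjoint, at most
    one does. *)
Lemma upper_lower n x :
  upper_mass n x <= lower_mass n x + Num.max p (1 - p) ^+ n.
Proof.
rewrite /upper_mass (bigID (fun k : 'I__ => k.+1%:R <= x * 2 ^+ n)) /=.
apply: lerD; first by apply: weighted_sum_mono => k /andP[].
have [[k /andP[kx xk]]|] := pselect (exists k : 'I_(2 ^ n),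
    (k%:R <= x * 2 ^+ n) && ~~ (k.+1%:R <= x * 2 ^+ n)).
  rewrite (big_pred1 k) ?weaver_pmf_le// => j /=.
  apply/idP/eqP => [/andP[jx xj]|->]; last by rewrite kx.
  apply/val_inj/eqP => /=; move: xk xj; rewrite -!ltNge => xk xj.
  have := le_lt_trans jx xk; have := le_lt_trans kx xj.
  by rewrite !ltr_nat !ltnS eqn_leq => -> ->.
move=> no; rewrite big1 => [|k xk]; last by case: no; exists k.
by rewrite exprn_ge0// le_max p_ge0.
Qed.

Lemma lower_mass_le0 n x : x <= 0 -> lower_mass n x = 0.
Proof.
move=> x0; rewrite /lower_mass big_pred0// => k; apply/negbTE.
rewrite -ltNge (@le_lt_trans _ _ 0)// ?ltr0n//.
by rewrite mulr_le0_ge0// exprn_ge0.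
Qed.

Lemma lower_mass_ge1 n x : 1 <= x -> lower_mass n x = 1.
Proof.
move=> x1; rewrite -(weaver_pmf_sum1 n); apply: eq_bigl => k.
rewrite -[RHS]/true; apply/idP.
rewrite (@le_trans _ _ (2 ^+ n))//; first by rewrite -natrX ler_nat.
by rewrite ler_peMl// exprn_ge0.
Qed.

(** * The common limit distribution function *)

Definition binomial_cdf (x : R) : R := limn (lower_mass ^~ x).

(** The comparison between different orders goes through their maximum. *)
Lemma lower_le_upper m n x : lower_mass m x <= upper_mass n x.
Proof.
apply: (le_trans (lower_mass_nondecreasing x _ _ (leq_maxl m n))).
apply: (le_trans (lower_upper _ _)).
exact: upper_mass_nonincreasing (leq_maxr m n).
Qed.

Lemma is_cvg_lower_mass x : cvgn (lower_mass ^~ x).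
Proof.
apply: nondecreasing_is_cvgn; first exact: lower_mass_nondecreasing.
by exists (upper_mass 0 x) => _ [n _ <-]; exact: lower_le_upper.
Qed.

Lemma lower_le_cdf n x : lower_mass n x <= binomial_cdf x.
Proof.
exact: (nondecreasing_cvgn_le (lower_mass_nondecreasing x) (is_cvg_lower_mass x)).
Qed.

Lemma cdf_le_upper n x : binomial_cdf x <= upper_mass n x.
Proof.
apply: (limr_le (f := lower_mass ^~ x) (is_cvg_lower_mass x)).
by apply: nearW => m; exact: lower_le_upper.
Qed.

Lemma cvg_lower_mass x : lower_mass n x @[n --> \oo] --> binomial_cdf x.
Proof. exact: is_cvg_lower_mass. Qed.

Lemma cvg_upper_mass x : upper_mass n x @[n --> \oo] --> binomial_cdf x.
Proof.
apply: (@squeeze_cvgr _ _ _ _ (lower_mass ^~ x)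
    (fun n => lower_mass n x + Num.max p (1 - p) ^+ n)).
- by apply: nearW => n; rewrite lower_upper upper_lower.
- exact: cvg_lower_mass.
rewrite -[X in _ --> X]addr0.
by apply: cvgD; [exact: cvg_lower_mass|exact: cvg_max_expr].
Qed.

Lemma binomial_cdf_nondecreasing : nondecreasing_fun binomial_cdf.
Proof.
move=> x y xy; rewrite /binomial_cdf; apply: ler_lim; [exact: is_cvg_lower_mass..|].
by apply: nearW => n; exact: lower_mass_le.
Qed.

(** The upper mass is a step function, right-continuous since an interval is
    counted from its left endpoint on. *)
Lemma upper_mass_near_right n x :
  \forall y \near x^'+, upper_mass n y <= upper_mass n x.
Proof.
have x2 : 0 < (2 ^+ n : R) by rewrite exprn_gt0.
near=> y; apply: weighted_sum_mono => k ky.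
(* No interval starts strictly between [x] and the next multiple of
   [1 / 2 ^ n]. *)
have : k%:~R < (Num.floor (x * 2 ^+ n) + 1)%:~R :> R.
  apply: (le_lt_trans ky); rewrite -ltr_pdivlMr//.
  near: y; apply: nbhs_right_lt; rewrite ltr_pdivlMr//.
  exact: floorD1_gt.
rewrite ltr_int ltzD1 floor_ge_int//.
Unshelve. all: by end_near. Qed.

(** For [y] slightly greater than [x], the value at [y] is at most the upper
    mass at [x], which exceeds the value at [x] by at most
    [max(p, 1 - p) ^ n]. *)
Lemma binomial_cdf_right_continuous : right_continuous binomial_cdf.
Proof.
move=> x; apply/cvgrPdist_le => e e0.
have [n _ qe] : \forall n \near \oo, Num.max p (1 - p) ^+ n <= e.
  have /cvgrPdist_le/(_ _ e0) := cvg_max_expr; apply: filterS => n.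
  by apply: le_trans; rewrite sub0r normrN ler_norm.
near=> y; rewrite distrC ger0_norm ?subr_ge0; last first.
  by apply: binomial_cdf_nondecreasing; near: y; exact: nbhs_right_ge.
rewrite lerBlDl (le_trans (cdf_le_upper n y))//.
apply: (@le_trans _ _ (upper_mass n x)); first by near: y; exact: upper_mass_near_right.
by rewrite (le_trans (upper_lower n x))// lerD ?lower_le_cdf ?qe /=.
Unshelve. all: by end_near. Qed.

Lemma binomial_cdf_le0 x : x <= 0 -> binomial_cdf x = 0.
Proof.
move=> x0; rewrite /binomial_cdf (_ : lower_mass ^~ x = cst 0) ?lim_cst//.
by apply/funext => n; exact: lower_mass_le0.
Qed.

Lemma binomial_cdf_ge1 x : 1 <= x -> binomial_cdf x = 1.
Proof.
move=> x1; rewrite /binomial_cdf (_ : lower_mass ^~ x = cst 1) ?lim_cst//.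
by apply/funext => n; exact: lower_mass_ge1.
Qed.

(** Here [a k] is the fraction, at the left of [x], of the mass carried by the
    [k]-th interval; the bounds hold however the mass is arranged inside the
    intervals. *)
Lemma weaver_sum_squeeze n x (a : 'I_(2 ^ n) -> \bar R) :
  (forall k, 0 <= a k <= 1)%E ->
  (forall k : 'I_(2 ^ n), k.+1%:R <= x * 2 ^+ n -> a k = 1%E) ->
  (forall k : 'I_(2 ^ n), x * 2 ^+ n < k%:R -> a k = 0%E) ->
  ((lower_mass n x)%:E <= \sum_(k < 2 ^ n) (weaver_pmf p n k)%:E * a k
     <= (upper_mass n x)%:E)%E.
Proof.
move=> a01 a1 a0; rewrite /lower_mass /upper_mass -!sumEFin.
apply/andP; split; [rewrite big_mkcond|rewrite [leRHS]big_mkcond];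
  apply: lee_sum => k _; case: ifPn => kx.
- by rewrite a1// mule1.
- by rewrite mule_ge0 ?lee_fin ?weaver_pmf_ge0//; case/andP: (a01 k).
- by rewrite -[leRHS]mule1 lee_wpmul2l ?lee_fin ?weaver_pmf_ge0//;
    case/andP: (a01 k).
- by rewrite a0 ?mule0// ltNge.
Qed.

Lemma limit_distribution_squeeze (m_ : nat -> set R -> \bar R)
    (mu : probability R R) :
  (forall x, mu `]-oo, x]%classic = (binomial_cdf x)%:E) ->
  (forall n x, (lower_mass n x)%:E <= m_ n `]-oo, x]%classic
                                   <= (upper_mass n x)%:E)%E ->
  limit_distribution m_ mu.
Proof.
move=> muE m_sq x; rewrite /distribution_function muE.
apply: (@squeeze_cvge _ _ _ _ (fun n => (lower_mass n x)%:E) _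
  (fun n => (upper_mass n x)%:E)).
- by apply: nearW => n; exact: m_sq.
- by apply: cvg_EFin; [exact: nearW|exact: cvg_lower_mass].
- by apply: cvg_EFin; [exact: nearW|exact: cvg_upper_mass].
Qed.

End Mass.

(** * Weaver's distributions *)

(** The grid of step [1 / (2 ^ n - 1)] stays inside the dyadic one: the point
    [k / (2 ^ n - 1)] lies in the closed [k]-th dyadic interval of order [n],
    because it is [(k + t) / 2 ^ n], where [t] is the point itself and
    [0 <= t <= 1]. *)
Lemma weaver_point_bounds {R : realType} n k (x : R) : (k < 2 ^ n)%N ->
  (k.+1%:R <= x * 2 ^+ n -> weaver_point n k <= x :> R) /\
  (x * 2 ^+ n < k%:R -> x < weaver_point n k :> R).
Proof.
case: k => [_|k k2].
  rewrite /weaver_point mul0r pmulr_llt0 ?exprn_gt0//; split=> // x0.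
  by rewrite -(@pmulr_lge0 _ (2 ^+ n)) ?exprn_gt0// (le_trans _ x0).
have kM : k.+1%:R <= (2 ^ n - 1)%N%:R :> R.
  by rewrite ler_nat -ltnS subn1 prednK ?expn_gt0.
have ME : 2 ^+ n = (2 ^ n - 1)%N%:R + 1 :> R.
  by rewrite -natrX natrB ?expn_gt0// subrK.
have M0 : 0 < (2 ^ n - 1)%N%:R :> R by rewrite (lt_le_trans _ kM).
rewrite /weaver_point ler_pdivrMr// ltr_pdivlMr// ME -(natr1 k.+1).
move: (2 ^ n - 1)%N%:R (k.+1%:R : R) (ltr0Sn R k) kM M0 => M j j0 jM M0.
have [x1|x1] := leP 1 x; have [x0|x0] := leP 0 x; split; nra.
Qed.

Lemma weaver_dist_squeeze {R : realType} (p : R) (p01 : 0 < p < 1) n x :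
  ((lower_mass p n x)%:E <= weaver_dist p n `]-oo, x]%classic
     <= (upper_mass p n x)%:E)%E.
Proof.
rewrite /weaver_dist; apply: weaver_sum_squeeze => // k.
- by rewrite diracE; case: (_ \in _); rewrite ?lexx ?lee01.
- move=> kx; rewrite diracE mem_set//= in_itv /=.
  by case: (weaver_point_bounds n k x (ltn_ord k)) => + _; exact.
- move=> kx; rewrite diracE memNset//= in_itv /=; apply/negP; rewrite -ltNge.
  by case: (weaver_point_bounds n k x (ltn_ord k)) => _; exact.
Qed.

(** * The p model *)

Section Uniform.
Context {R : realType} (a b : R) (ab : a < b).
Local Open Scope ereal_scope.

Lemma uniform_prob_sub (A : set R) : `[a, b] `<=` A -> uniform_prob ab A = 1.
Proof. exact: integral_uniform_pdf1. Qed.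

Lemma uniform_prob_disjoint (A : set R) :
  A `&` `[a, b] = set0 -> uniform_prob ab A = 0.
Proof.
by move=> A0; rewrite /uniform_prob integral_uniform_pdf A0 integral_set0.
Qed.

Lemma uniform_prob_interior : uniform_prob ab `]a, b[ = 1.
Proof.
rewrite /uniform_prob (eq_integral (fun=> (b - a)^-1%:E)); last first.
  move=> x; rewrite inE/= in_itv/= /uniform_pdf => /andP[/ltW -> /ltW ->//].
rewrite integral_cst//= lebesgue_measure_itv/= lte_fin.
by rewrite ab -EFinD -EFinM mulVf// gt_eqF// subr_gt0.
Qed.

End Uniform.

Section PModel.
Context {R : realType} (p : R).
Hypothesis p01 : (0 < p < 1)%R.
Local Open Scope ereal_scope.

Lemma dyadic_uniform_interval n j k :
  dyadic_uniform n j (dyadic_interval n k) = (j == k)%:R%:E :> \bar R.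
Proof.
have [<-|jk] := eqVneq; first exact: uniform_prob_interior.
apply: uniform_prob_disjoint; apply/seteqP; split => // x [] /=.
rewrite !in_itv /= => /andP[kx xk] /andP[jx xj].
have := lt_le_trans kx xj; have := le_lt_trans jx xk.
rewrite !ltr_pM2r ?invr_gt0 ?exprn_gt0// !ltr_nat !ltnS => h1 h2.
by move/eqP: jk; apply; apply/eqP; rewrite eqn_leq h1.
Qed.

(** The recursion reads the mass of an interval by measuring it; since the
    uniform laws of the other intervals do not charge it, the value is
    [weaver_pmf p n k], and its division between the halves reproduces
    [weaver_pmf] of the next order. *)
Lemma p_modelE n A : p_model p n A =
  \sum_(k < 2 ^ n) (weaver_pmf p n k)%:E * dyadic_uniform n k A.
Proof.
elim: n A => [|n IHn] A /=.
  rewrite big_ord1 weaver_pmf0 mul1e /dyadic_uniform /uniform_prob.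
  by rewrite expr0 !divr1.
rewrite expnS (big_ord_double _ _ _ _
  (fun k => (weaver_pmf p n.+1 k)%:E * dyadic_uniform n.+1 k A)).
apply: eq_bigr => k _; rewrite IHn (bigD1 k)//= big1 => [|j jk]; last first.
  by rewrite dyadic_uniform_interval (negbTE (jk : j != k :> nat)) mule0.
rewrite dyadic_uniform_interval eqxx mule1 adde0.
have /andP[/ltW p_ge0 /ltW p_le1] := p01.
rewrite /= weaver_pmf_left weaver_pmf_right [((1 - p) * _)%:E]EFinM.
rewrite [(p * _)%:E]EFinM muleDr//; first by rewrite !muleA ![_ * (weaver_pmf p n k)%:E]muleC.
by apply: ge0_adde_def; rewrite inE mule_ge0 ?measure_ge0 ?lee_fin ?subr_ge0.
Qed.

Lemma p_model_squeeze n x :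
  (lower_mass p n x)%:E <= p_model p n `]-oo, x] <= (upper_mass p n x)%:E.
Proof.
have x2 : (0 < 2 ^+ n :> R)%R by rewrite exprn_gt0.
rewrite p_modelE; apply: weaver_sum_squeeze => // k.
- by rewrite measure_ge0 probability_le1.
- rewrite -ler_pdivrMr// => kx; apply: uniform_prob_sub => y /=.
  by rewrite !in_itv/= => /andP[_ /le_trans]; exact.
- rewrite -ltr_pdivlMr// => xk; apply: uniform_prob_disjoint.
  apply/seteqP; split => // y [] /=; rewrite !in_itv/= => yx /andP[ky _].
  by have := lt_le_trans xk (le_trans ky yx); rewrite ltxx.
Qed.

End PModel.

(** * Probabilities and their distribution functions *)

Section Cdf.
Context {R : realType}.

Lemma probability_with_cdf (F : R -> R) :
  nondecreasing_fun F -> right_continuous F ->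
  F @ -oo --> (0 : R) -> F @ +oo --> (1 : R) ->
  exists mu : probability R R, forall x, mu `]-oo, x]%classic = (F x)%:E.
Proof.
move=> Fnd Frc F0 F1.
pose cF := isCumulative.Build R _ R F Fnd Frc.
pose bF := isCumulativeBounded.Build R 0 1 F F0 F1.
pose f : cumulativeBounded (0 : R) (1 : R) := HB.pack F cF bF.
(* The Lebesgue-Stieltjes measure lives on the sigma-algebra generated by the
   intervals [`]a, b]]; the law of the identity carries it to the Borel
   structure of [R]. *)
pose idTR : measurableTypeR R -> R := idfun.
pose mX := @isMeasurableFun.Build _ _ (measurableTypeR R) R idTR
  (@measurable_id _ _ setT).
pose X : {mfun measurableTypeR R >-> R} := HB.pack idTR mX.
exists (distribution (lebesgue_stieltjes_measure f) X) => x.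
have := cdf_lebesgue_stieltjes_id f x.
by rewrite /cdf /distribution /pushforward preimage_id.
Qed.

(** The rays [`]x, +oo[], complements of those that the distribution function
    measures, are stable under intersection and generate the Borel sets. *)
Lemma probability_cdf_unique (P Q : probability R R) :
  (forall x, P `]-oo, x]%classic = Q `]-oo, x]%classic) ->
  forall A, measurable A -> P A = Q A.
Proof.
move=> PQ; apply: (@measure_unique _ R R (@RGenOInfty.G R)
  (fun n => `](- n%:R), +oo[%classic) _ _ _ _ P Q).
- exact: RGenOInfty.measurableE.
- move=> _ _ [x ->] [y ->]; exists (Num.max x y).
  by apply/seteqP; split => z /=; rewrite !in_itv/= !andbT gt_max; [case=> -> ->|case/andP].
- by move=> n; eexists.
- apply/seteqP; split => // x _; exists (Num.truncn (- x)).+1 => //=.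
  by rewrite in_itv/= andbT ltrNl truncnS_gt.
- move=> _ [x ->]; change (P `]x, +oo[%classic = Q `]x, +oo[%classic).
  by rewrite -setCitvl !probability_setC// PQ.
- by move=> n; rewrite (le_lt_trans (probability_le1 _ _)) ?ltry.
Qed.

Lemma probability_unit_interval (P : probability R R) :
  P `]-oo, 0]%classic = 0%E -> P `]-oo, 1]%classic = 1%E ->
  P `[0, 1]%classic = 1%E.
Proof.
move=> P0 P1; apply/eqP; rewrite eq_le probability_le1//= -{1}P1.
rewrite -[leRHS]add0e -[X in (X + _)%E]P0.
apply: le_trans (measureU2 _ _ _) => //.
apply: le_measure; rewrite ?inE//; first exact: measurableU.
move=> x /=; rewrite !in_itv/= => ->.
by case: (leP x 0) => [|/ltW ->]; [left|right].
Qed.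

End Cdf.

(** * The limit measure *)

Lemma probability_binomial_cdf (R : realType) (p : R) (hp : 0 < p < 1) :
  exists mu : probability R R,
    forall x, mu `]-oo, x]%classic = (binomial_cdf p x)%:E.
Proof.
apply: probability_with_cdf.
- exact: binomial_cdf_nondecreasing.
- exact: binomial_cdf_right_continuous.
- apply: cvg_near_cst; near=> x; apply: binomial_cdf_le0.
  by near: x; exact: nbhs_ninfty_le.
- apply: cvg_near_cst; near=> x; apply: binomial_cdf_ge1.
  by near: x; exact: nbhs_pinfty_ge.
Unshelve. all: by end_near. Qed.

Theorem theorem11 (R : realType) (p : R) (hp : 0 < p < 1) :
  (exists W : probability R R, is_weavers_hem p W) /\
  (exists B : probability R R, is_binomial_measure p B) /\
  (forall W B : probability R R,
     is_weavers_hem p W -> is_binomial_measure p B ->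
     W `[0, 1]%classic = 1%E /\ forall A : set R, measurable A -> W A = B A).
Proof.
have [mu muE] := probability_binomial_cdf R p hp.
have hem : is_weavers_hem p mu.
  by apply: (limit_distribution_squeeze p hp _ _ muE) => n x; exact: weaver_dist_squeeze.
have bin : is_binomial_measure p mu.
  by apply: (limit_distribution_squeeze p hp _ _ muE) => n x; exact: p_model_squeeze.
split; first by exists mu.
split; first by exists mu.
move=> W B hW hB.
have WE x : W `]-oo, x]%classic = (binomial_cdf p x)%:E.
  by rewrite -muE; exact: cvg_unique (hW x) (hem x).
have BE x : B `]-oo, x]%classic = (binomial_cdf p x)%:E.
  by rewrite -muE; exact: cvg_unique (hB x) (bin x).
split; last by apply: probability_cdf_unique => x; rewrite WE BE.
by apply: probability_unit_interval;
  rewrite WE ?(binomial_cdf_le0 _ _ (lexx 0)) ?binomial_cdf_ge1.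
Qed.
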